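(* Suppose $R$ is a Dedekind domain with fraction field $K$. Then the map $\mathfrak{p} \mapsto v_{\mathfrak{p}}$ is a bijection from the set of nonzero prime ideals of $R$ to the set of discrete valuations of $K$ that are nonnegative on $R$.
   Context: A Dedekind domain is an integral domain that is Noetherian, integrally closed in its fraction field, and in which every nonzero prime ideal is maximal (fields are regarded as Dedekind domains). A discrete valuation of a field $K$ is a surjective group homomorphism $v\colon K^\times \to \mathbb{Z}$ (from the multiplicative group of $K$ to the additive group $\mathbb{Z}$) such that $v(x+y)\ge \min\{v(x),v(y)\}$ for all $x,y\in K^\times$ with $x+y\neq 0$; by convention $v(0)=\infty$. Its valuation ring is $\mathcal{O}_v=\{x\in K\mid v(x)\ge 0\}$, and rings of this form are called discrete valuation rings (DVRs). For a nonzero prime ideal $\mathfrak{p}$ of a Dedekind domain $R$ with fraction field $K$, the localization $R_{\mathfrak{p}}\subseteq K$ is a DVR, and $v_{\mathfrak{p}}\colon K^\times\to\mathbb{Z}$ denotes the discrete valuation associated with $R_{\mathfrak{p}}$, i.e. the unique discrete valuation of $K$ with $\mathcal{O}_{v_{\mathfrak{p}}}=R_{\mathfrak{p}}$. *)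

(* Defs.v *)
From mathcomp Require Export all_boot all_order all_algebra.
From mathcomp Require Export boolp classical_sets functions constructive_ereal.

Set Implicit Arguments.
Unset Strict Implicit.
Unset Printing Implicit Defensive.

Import Order.TTheory GRing.Theory Num.Theory.
Local Open Scope classical_set_scope.
Local Open Scope ring_scope.

Local Notation "x %:F" := (FracField.tofrac x).

(* [idealr_closed] only holds of proper ideals. In [noetherian] nothing is lost
   by omitting the unit ideal, which is generated by 1. *)
Definition proper_ideal_set (R : idomainType) (I : set R) : Prop :=
  idealr_closed (mem I).

Definition prime_ideal_set (R : idomainType) (p : set R) : Prop :=
  proper_ideal_set p /\ prime_idealr_closed (mem p).

Definition maximal_ideal_set (R : idomainType) (m : set R) : Prop :=
  proper_ideal_set m /\
  forall J : set R, proper_ideal_set J -> m `<=` J -> J = m.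

Definition ideal_span (R : idomainType) (s : seq R) : set R :=
  [set x | exists c : 'I_(size s) -> R, x = \sum_(i < size s) c i * s`_i].

Definition noetherian (R : idomainType) : Prop :=
  forall I : set R, proper_ideal_set I -> exists s : seq R, I = ideal_span s.

Definition integrally_closed (R : idomainType) : Prop :=
  forall z : {fraction R}, integralOver (@FracField.tofrac R) z ->
    exists a : R, z = a%:F.

Definition nonzero_primes (R : idomainType) : set (set R) :=
  [set p | prime_ideal_set p /\ p <> [set 0]].

(* Fields satisfy this: they have no nonzero prime ideal. *)
Definition dedekind (R : idomainType) : Prop :=
  [/\ noetherian R, integrally_closed R &
      forall p : set R, nonzero_primes p -> maximal_ideal_set p].

(* A discrete valuation K^* -> Z is encoded by its extension to K with value
   +oo at 0, so that distinct valuations correspond to distinct functions. *)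
Definition discrete_valuation (K : fieldType) (v : K -> \bar int) : Prop :=
  [/\ v 0 = +oo%E,
      forall x : K, x != 0 -> v x \is a fin_num,
      forall x y : K, x != 0 -> y != 0 -> v (x * y) = (v x + v y)%E,
      forall n : int, exists2 x : K, x != 0 & v x = n%:E &
      forall x y : K, x != 0 -> y != 0 -> x + y != 0 ->
        (Order.min (v x) (v y) <= v (x + y)%R)%E].

Definition valuation_ring (K : fieldType) (v : K -> \bar int) : set K :=
  [set x | (0 <= v x)%E].

Definition localization (R : idomainType) (p : set R) : set {fraction R} :=
  [set x | exists a s : R, ~ p s /\ x = a%:F / s%:F].

(* Definite description: the unique discrete valuation of Frac R whose
   valuation ring is R_p. The default value 0 is not a discrete valuation (it
   is not surjective). *)
Definition prime_valuation (R : idomainType) (p : set R) :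
    {fraction R} -> \bar int :=
  xget (fun=> 0%E) [set v | unique
    (fun w => discrete_valuation w /\ valuation_ring w = localization p) v].

Definition nonneg_valuations (R : idomainType) :
    set ({fraction R} -> \bar int) :=
  [set v | discrete_valuation v /\
           forall a : R, (0 <= v a%:F)%E].

(* Main.v *)
Require Import Defs.
From mathcomp Require Import ring.

(** The heart of the matter is that the localization [R_p] at a nonzero prime
[p] of a Dedekind domain [R] is a discrete valuation ring of the fraction field.
All arguments take place in the fraction field: [R_p] is a set of fractions, and
its ideals enter through their traces on [R], so that only the Noetherian
property of [R] is ever needed ([noetherian_maximal]).

A uniformizer is found as follows. Let [a] be a nonzero element of [p]. Among
the annihilators in [R] of nonzero classes of [R_p / a R_p] choose a maximal
one. It is prime and nonzero, hence maximal because [R] has dimension one, and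
it lies in [p]; so it is [p] itself. If it annihilates the class of [b], then
[x = b / a] is not in [R_p] but multiplies [p] into [R_p]
([localization_conductor]). It cannot multiply [p] into [p R_p]: otherwise a
multiple [t x] with [t] outside [p] would stabilize the finitely generated
ideal [p], so it would be integral over [R] ([integral_of_stable_span]) and thus
in [R], which puts [x] in [R_p]. Hence [m x] is a unit of [R_p] for some [m] in
[p], and [m] generates [p R_p] ([localization_uniformizer]). A second
application of the Noetherian property writes every nonzero fraction as a power
of [m] times a unit ([localization_factor]), and the exponent is a discrete
valuation ([discrete_valuation_of_uniformizer]).

A discrete valuation is determined by its ring ([valuation_ring_inj]), so the
definite description of [prime_valuation] is met. Injectivity follows because
[R_p] determines [p]: a nonzero [a] in [R] lies in [p] exactly when [1 / a] is
not in [R_p]. For surjectivity, let [v] be nonnegative on [R]. Its center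
[{a | v a > 0}] is a nonzero prime [p], and the ring of [v] contains [R_p]; a
fraction outside [R_p] has its inverse in [p R_p], where [v] is positive, so the
two rings are equal ([valuation_ring_center]) and [v] is the valuation of
[p]. *)

Set Implicit Arguments.
Unset Strict Implicit.
Unset Printing Implicit Defensive.

Import Order.TTheory GRing.Theory Num.Theory.
Local Open Scope classical_set_scope.
Local Open Scope ring_scope.

Local Notation "x %:F" := (FracField.tofrac x).

(** * Ideals of Noetherian domains *)

Lemma proper_ideal_setP (R : idomainType) (I : set R) :
  proper_ideal_set I <->
  [/\ I 0, ~ I 1 & forall a u v, I u -> I v -> I (a * u + v)].
Proof.
split=> -[I0 I1 IL]; split.
- exact: set_mem I0.
- by move=> /mem_set H; move/negP: I1.
- by move=> a u v Iu Iv; apply/set_mem/IL; apply/mem_set.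
- exact: mem_set.
- by apply/negP => /set_mem.
- by move=> a u v /set_mem Iu /set_mem Iv; apply/mem_set/IL.
Qed.

Lemma prime_ideal_setP (R : idomainType) (p : set R) :
  prime_ideal_set p <->
  proper_ideal_set p /\ forall u v, p (u * v) -> p u \/ p v.
Proof.
split=> -[pI pP]; split=> // u v.
- by move=> /mem_set /pP /orP[] /set_mem; [left|right].
- by move=> /set_mem /pP[] /mem_set h; apply/orP; [left|right].
Qed.

Lemma ideal_span_mem (R : idomainType) (s : seq R) (x : R) :
  x \in s -> ideal_span s x.
Proof.
move=> /(nthP 0)[i lt_i <-]; exists (fun j => (j == Ordinal lt_i)%:R).
rewrite (bigD1 (Ordinal lt_i)) //= eqxx mul1r big1 ?addr0 // => j /negbTE ->.
by rewrite mul0r.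
Qed.

Lemma ideal_span_sub (R : idomainType) (s : seq R) (P : set R) :
  P 0 -> (forall a u v, P u -> P v -> P (a * u + v)) ->
  (forall x, x \in s -> P x) -> ideal_span s `<=` P.
Proof.
move=> P0 PL Ps x [c ->]; elim/big_ind: _ => // [u v Pu Pv|i _].
  by rewrite -[u]mul1r; apply: PL.
by rewrite -[_ * _]addr0; apply: PL => //; apply/Ps/mem_nth.
Qed.

(** The union of a chain of ideals is finitely generated, so the finitely many
generators already lie in one member, which is then the whole union. *)
Lemma noetherian_maximal (R : idomainType) (F : set (set R)) (I0 : set R) :
  noetherian R -> F `<=` @proper_ideal_set R -> F I0 ->
  exists2 I, F I & forall J, F J -> I `<=` J -> J = I.
Proof.
move=> noeR idF FI0.
(* The empty set is added to the family to bound the empty chain. *)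
pose P := [set I : set R | I = set0 \/ F I].
have [] := @Zorn_bigcup _ P.
  move=> G GP totG.
  have [[X0 [GX0 FX0]]|noF] := pselect (exists X, G X /\ F X); last first.
    left; rewrite -subset0 => x [X GX Xx].
    have [X0|FX] := GP _ GX; first by rewrite -X0.
    by case: noF; exists X.
  set U := \bigcup_(X in G) X.
  have idU : proper_ideal_set U.
    apply/proper_ideal_setP; split.
    - by exists X0 => //; have /proper_ideal_setP[] := idF _ FX0.
    - move=> [X GX X1]; have [X0'|/idF/proper_ideal_setP[]//] := GP _ GX.
      by rewrite X0' in X1.
    - have step X a u v : G X -> X u -> X v -> U (a * u + v).
        move=> GX Xu Xv; exists X => //; have [X0'|] := GP _ GX.
          by rewrite X0' in Xu.
        by move=> /idF/proper_ideal_setP[_ _]; apply.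
      move=> a u v [X GX Xu] [Y GY Yv]; have [XY|YX] := totG _ _ GX GY.
        by apply: (step Y) => //; apply: XY.
      by apply: (step X) => //; apply: YX.
  have [s Us] := noeR _ idU.
  have [X [GX FX Xs]] : exists X, [/\ G X, F X & forall x, x \in s -> X x].
    have : forall x, x \in s -> U x by move=> x; rewrite Us => /ideal_span_mem.
    elim: {Us} s => [|x s IHs] sU; first by exists X0.
    have [|X [GX FX Xs]] := IHs.
      by move=> y ys; apply: sU; rewrite inE ys orbT.
    have [Y GY Yx] := sU x (mem_head _ _).
    have [XY|YX] := totG _ _ GX GY.
      exists Y; split=> // [|y]; last by rewrite inE => /predU1P[->//|/Xs/XY].
      have [Y0|//] := GP _ GY; by rewrite Y0 in Yx.
    by exists X; split=> // y; rewrite inE => /predU1P[->|/Xs//]; apply: YX.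
  right; suff -> : U = X by [].
  apply/seteqP; split; last by move=> x Xx; exists X.
  have /proper_ideal_setP[X_0 _ XL] := idF _ FX.
  by rewrite Us; apply: ideal_span_sub.
move=> I [PI maxI]; have [I_0|FI] := PI.
  have /proper_ideal_setP[I00 _ _] := idF _ FI0.
  case: (maxI I0); last by right.
  by rewrite I_0; split=> [x //|/(_ _ I00)].
exists I => // J FJ IJ; apply/seteqP; split=> //.
by apply: contrapT => JI; apply: (maxI J); [split|right].
Qed.

(** * Fractions and integrality *)

Lemma fracE (R : idomainType) (x : {fraction R}) :
  exists a b : R, b != 0 /\ x = a%:F / b%:F.
Proof.
elim/quotW: x => r; exists \n_r, \d_r; have d0 := denom_ratioP r.
have dF0 : (\d_r)%:F != 0 by rewrite tofrac_eq0.
split=> //; apply: (mulIf dF0); rewrite divfK //.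
unlock FracField.tofrac; rewrite -[LHS]FracField.pi_mul; apply/eqP.
rewrite FracField.equivf_def /FracField.mulf /FracField.equivf.
by rewrite !numden_Ratio ?mulf_neq0 ?oner_neq0 // !mulr1 mulrC.
Qed.

(** Determinant trick: multiplication by [z] acts on a generating family
of the ideal through a matrix over [R], and [z] is a root of its
characteristic polynomial. *)
Lemma integral_of_stable_span (R : idomainType) (s : seq R) (z : {fraction R}) :
  ideal_span s <> [set 0] ->
  (forall x, ideal_span s x -> exists2 y, ideal_span s y & z * x%:F = y%:F) ->
  integralOver (@FracField.tofrac R) z.
Proof.
move=> s_neq0 stab.
have /choice[c cP] (i : 'I_(size s)) : exists c : 'I_(size s) -> R,
    z * (s`_i)%:F = (\sum_(j < size s) c j * s`_j)%:F.
  have [|y [c ->] ->] := stab s`_i; last by exists c.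
  by apply/ideal_span_mem/mem_nth.
pose M := \matrix_(i, j) c j i.
exists (char_poly M); first exact: char_poly_monic.
rewrite map_char_poly -eigenvalue_root_char; apply/eigenvalueP.
exists (\row_i (s`_i)%:F).
  apply/rowP => j; rewrite !mxE cP rmorph_sum; apply: eq_bigr => i _.
  by rewrite !mxE rmorphM mulrC.
apply: contra_notN s_neq0 => /eqP/rowP s0; apply/seteqP; split=> x /=.
  move=> [d ->]; apply: big1 => i _.
  have /eqP := s0 i; rewrite !mxE tofrac_eq0 => /eqP ->; exact: mulr0.
by move=> ->; exists (fun=> 0); rewrite big1 // => i _; rewrite mul0r.
Qed.

(** * Discrete valuations of a field *)

Section DiscreteValuation.
Variables (K : fieldType) (v : K -> \bar int).
Hypothesis dv : discrete_valuation v.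

Lemma dvE x : x != 0 -> v x = (fine (v x))%:E.
Proof. by case: dv => _ fv _ _ _ x0; rewrite fineK ?fv. Qed.

Lemma dv_fineM x y : x != 0 -> y != 0 ->
  fine (v (x * y)) = fine (v x) + fine (v y).
Proof.
by case: dv => _ fv vM _ _ x0 y0; rewrite vM// fineD ?fv.
Qed.

Lemma dv_fine1 : fine (v 1) = 0.
Proof.
apply: (@addrI _ (fine (v 1))).
by rewrite addr0 -dv_fineM ?oner_neq0 // mulr1.
Qed.

Lemma dv_fineV x : x != 0 -> fine (v x^-1) = - fine (v x).
Proof.
move=> x0; apply: (@addrI _ (fine (v x))).
by rewrite -dv_fineM ?invr_eq0 // divff // dv_fine1 subrr.
Qed.

Lemma dv_fineXz x (n : int) : x != 0 -> fine (v (x ^ n)) = fine (v x) * n.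
Proof.
move=> x0; elim/int_rect: n => [|n IHn|n IHn].
- by rewrite expr0z dv_fine1 mulr0.
- rewrite -addn1 PoszD expfzDr // dv_fineM ?expfz_neq0 // IHn.
  by rewrite expr1z mulrDr mulr1.
- rewrite -addn1 PoszD opprD expfzDr // dv_fineM ?expfz_neq0 // IHn.
  by rewrite exprN1 dv_fineV // mulrDr mulrN1.
Qed.

Lemma valuation_ringE x : x != 0 -> valuation_ring v x <-> 0 <= fine (v x).
Proof. by move=> x0; rewrite /valuation_ring /= dvE // lee_fin. Qed.

Lemma valuation_ring_unitP x : x != 0 ->
  valuation_ring v x /\ valuation_ring v x^-1 <-> fine (v x) = 0.
Proof.
move=> x0; rewrite !valuation_ringE ?invr_eq0 // dv_fineV // oppr_ge0.
split=> [[v_ge0 v_le0]|->//]; by apply/eqP; rewrite eq_le v_le0.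
Qed.

End DiscreteValuation.

(** Every nonzero [x] is an integral power of an element [t] of value 1 times
an element of value 0, and the latter are the units of the valuation ring. So
the ring determines [v] up to the scale fixed by the value of [t], and
surjectivity forces that scale to be 1. *)
Lemma valuation_ring_inj (K : fieldType) (v w : K -> \bar int) :
  discrete_valuation v -> discrete_valuation w ->
  valuation_ring v = valuation_ring w -> v = w.
Proof.
move=> dv dw vw.
have [t t0 vt] : exists2 t, t != 0 & fine (v t) = 1.
  by case: dv => _ _ _ /(_ 1)[t t0 vt] _; exists t; rewrite ?vt.
have scale x : x != 0 -> fine (w x) = fine (w t) * fine (v x).
  move=> x0; pose n := fine (v x).
  have tn0 : t ^ n != 0 by rewrite expfz_neq0.
  have xt0 : x / t ^ n != 0 by rewrite mulf_neq0 ?invr_eq0.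
  have : fine (v (x / t ^ n)) = 0.
    by rewrite dv_fineM ?invr_eq0 // dv_fineV // dv_fineXz // vt mul1r subrr.
  move=> /(valuation_ring_unitP dv xt0); rewrite vw.
  move=> /(valuation_ring_unitP dw xt0) /eqP.
  by rewrite dv_fineM ?invr_eq0 // dv_fineV // dv_fineXz // subr_eq0 => /eqP.
have wt : fine (w t) = 1.
  have wt_ge0 : 0 <= fine (w t).
    apply/(valuation_ringE dw t0); rewrite -vw.
    by apply/(valuation_ringE dv); rewrite ?vt.
  have [y y0 wy] : exists2 y, y != 0 & fine (w y) = 1.
    by case: dw => _ _ _ /(_ 1)[y y0 wy] _; exists y; rewrite ?wy.
  move: wy; rewrite scale //; move: (fine (w t)) wt_ge0 (fine (v y)) => a a0 b.
  move=> /(congr1 absz)/eqP; rewrite abszM muln_eq1 => /andP[/eqP a1 _].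
  by rewrite -(gez0_abs a0) a1.
apply/funext => x; have [->|x0] := eqVneq x 0.
  by case: dv dw => -> _ _ _ _ [-> _ _ _ _].
by rewrite (dvE dv) // (dvE dw) // scale // wt mul1r.
Qed.

(** The value of a nonzero [x] is the exponent [n] for which [x / t ^ n] is a
unit of [A]; it is unique because [t^-1] is not in [A]. *)
Lemma discrete_valuation_of_uniformizer (K : fieldType) (A : set K) (t : K) :
  A 0 -> (forall x y, A x -> A y -> A (x + y)) ->
  (forall x y, A x -> A y -> A (x * y)) -> A t -> ~ A t^-1 ->
  (forall x, x != 0 -> exists (n : int) u, [/\ x = t ^ n * u, A u & A u^-1]) ->
  exists2 v : K -> \bar int, discrete_valuation v & valuation_ring v = A.
Proof.
move=> A0 AD AM At AtV fact.
have t0 : t != 0 by apply: contra_notN AtV => /eqP ->; rewrite invr0.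
have A1 : A 1.
  have [n [u [u1 Au AuV]]] := fact 1 (oner_neq0 _).
  have u0 : u != 0.
    by apply: contra_eqN u1 => /eqP ->; rewrite mulr0 oner_neq0.
  by rewrite -(divff u0); apply: AM.
have AX n : A (t ^+ n) by elim: n => // n IHn; rewrite exprS; apply: AM.
have tX_A (n : int) : A (t ^ n) <-> 0 <= n.
  split=> [|]; last by case: n => // n _; apply: AX.
  case: n => // n; rewrite NegzE => h; exfalso; apply: AtV.
  suff -> : t^-1 = t ^ (- n.+1%:Z) * t ^+ n by apply: AM.
  rewrite -exprnN exprS invfM mulrAC -mulrA divff ?mulr1 // expf_neq0 //.
have /choice[f fP] x : exists n : int,
    x != 0 -> A (x / t ^ n) /\ A (x / t ^ n)^-1.
  have [->|x0] := eqVneq x 0; first by exists 0.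
  have [n [u [-> Au AuV]]] := fact x x0; exists n => _.
  by rewrite mulrAC divff ?mul1r // expfz_neq0.
have fA x n : x != 0 -> A (x / t ^ n) <-> n <= f x.
  move=> x0; have [h hV] := fP x x0.
  rewrite -[n <= _]subr_ge0 -tX_A expfzDr // -invr_expz.
  have -> : x / t ^ n = (x / t ^ f x) * (t ^ f x / t ^ n).
    by field; rewrite !expfz_neq0.
  split=> [H|]; last exact: AM.
  rewrite -[_ / _](mulKf (_ : x / t ^ f x != 0)); last first.
    by rewrite mulf_neq0 ?invr_eq0 ?expfz_neq0.
  exact: AM.
have f_uniq x n : x != 0 -> A (x / t ^ n) -> A (x / t ^ n)^-1 -> f x = n.
  move=> x0 h hV; apply/eqP; rewrite eq_le; apply/andP; split; last exact/fA.
  have [g gV] := fP x x0; rewrite -subr_ge0 -tX_A expfzDr //.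
  have -> : t ^ n * t ^ (- f x) = (x / t ^ n)^-1 * (x / t ^ f x).
    by rewrite -invr_expz; field; rewrite x0 !expfz_neq0.
  exact: AM.
have fM x y : x != 0 -> y != 0 -> f (x * y) = f x + f y.
  move=> x0 y0; have [gx gxV] := fP x x0; have [gy gyV] := fP y y0.
  have E : x * y / t ^ (f x + f y) = (x / t ^ f x) * (y / t ^ f y).
    by rewrite expfzDr //; field; rewrite !expfz_neq0.
  apply: f_uniq; rewrite ?mulf_neq0 // E; first exact: AM.
  by rewrite invfM; apply: AM.
exists (fun x => if x == 0 then +oo%E else (f x)%:E).
  split.
  - by rewrite eqxx.
  - by move=> x /negbTE ->.
  - by move=> x y x0 y0; rewrite mulf_eq0 (negbTE x0) (negbTE y0) /= fM.
  - move=> n; exists (t ^ n); rewrite ?(negbTE (expfz_neq0 _ _)) ?expfz_neq0 //.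
    by congr EFin; apply: f_uniq; rewrite ?divff ?invr1 ?expfz_neq0.
  - move=> x y x0 y0 xy0.
    rewrite (negbTE x0) (negbTE y0) (negbTE xy0) -EFin_min lee_fin.
    apply/fA => //; rewrite mulrDl; apply: AD; apply/fA => //.
      by rewrite ge_min lexx.
    by rewrite ge_min lexx orbT.
apply/seteqP; split=> x; rewrite /valuation_ring /=; have [->|x0] := eqVneq x 0.
- by [].
- by rewrite lee_fin => /(fA _ _ x0); rewrite expr0z divr1.
- by rewrite leey.
- by move=> Ax; rewrite lee_fin; apply/fA => //; rewrite expr0z divr1.
Qed.

(** * The localization at a prime *)

Section Localization.
Variables (R : idomainType) (p : set R).
Hypothesis p_prime : prime_ideal_set p.

Let A := localization p.

Let p_proper : proper_ideal_set p. Proof. by case: p_prime. Qed.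

Let p0 : p 0. Proof. by have /proper_ideal_setP[] := p_proper. Qed.

Let pN1 : ~ p 1. Proof. by have /proper_ideal_setP[] := p_proper. Qed.

Let pL a u v : p u -> p v -> p (a * u + v).
Proof. by have /proper_ideal_setP[_ _] := p_proper; apply. Qed.

Let pMl a u : p u -> p (a * u).
Proof. by move=> pu; rewrite -[_ * _]addr0; apply: pL. Qed.

Let pNM u v : ~ p u -> ~ p v -> ~ p (u * v).
Proof. by move=> pu pv; have /prime_ideal_setP[_ pP] := p_prime; case/pP. Qed.

Let notp_neq0 s : ~ p s -> s != 0.
Proof. by apply: contra_notN => /eqP ->. Qed.

Let notpF_neq0 s : ~ p s -> s%:F != 0.
Proof. by move=> /notp_neq0; rewrite tofrac_eq0. Qed.

Lemma localization_frac a : A a%:F.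
Proof. by exists a, 1; rewrite tofrac1 divr1. Qed.

Lemma localizationD x y : A x -> A y -> A (x + y).
Proof.
move=> [a [s [ps ->]]] [b [t [pt ->]]]; exists (a * t + b * s), (s * t).
split; first exact: pNM.
by rewrite tofracD !tofracM addf_div ?notpF_neq0.
Qed.

Lemma localizationM x y : A x -> A y -> A (x * y).
Proof.
move=> [a [s [ps ->]]] [b [t [pt ->]]]; exists (a * b), (s * t).
by split; [exact: pNM | rewrite !tofracM mulf_div].
Qed.

Lemma localization_nonunit x : A x -> ~ A x^-1 ->
  exists a s, [/\ p a, ~ p s & x = a%:F / s%:F].
Proof.
move=> [a [s [ps ->]]] xV; exists a, s; split=> //.
by apply: contrapT => pa; apply: xV; exists s, a; rewrite invf_div.
Qed.

Lemma localization_fracV a : a != 0 -> A (a%:F)^-1 <-> ~ p a.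
Proof.
move=> a0; split=> [[b [s [ps E]]] pa|pa]; last first.
  by exists 1, a; rewrite tofrac1 mul1r.
apply: (ps); suff -> : s = b * a by apply: pMl.
apply/eqP; rewrite -tofrac_eq tofracM.
have -> : b%:F = (a%:F)^-1 * s%:F by rewrite E divfK ?notpF_neq0.
by rewrite mulrAC mulVf ?mul1r // tofrac_eq0.
Qed.

(** For nonzero [x] this is the intersection of [x R_p] with [R]. *)
Definition trace_ideal (x : {fraction R}) : set R :=
  [set r | A (r%:F / x)].

Lemma trace_ideal_proper x : ~ A x^-1 -> proper_ideal_set (trace_ideal x).
Proof.
move=> xV; apply/proper_ideal_setP; rewrite /trace_ideal; split=> /=.
- by rewrite tofrac0 mul0r -tofrac0; apply: localization_frac.
- by rewrite tofrac1 mul1r.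
- move=> a u v Au Av; rewrite tofracD tofracM mulrDl -mulrA.
  apply: localizationD => //; apply: localizationM => //.
  exact: localization_frac.
Qed.

Section Dedekind.
Hypotheses (dedR : dedekind R) (p_neq0 : p <> [set 0]).

Let p_elt : exists2 a, p a & a != 0.
Proof.
apply: contrapT => H; apply: p_neq0; apply/seteqP; split=> [x px|x ->//] /=.
by apply/eqP; apply: contrapT => /negP x0; apply: H; exists x.
Qed.

(** For a nonzero [a] in [p] and [b] in [R], the trace of [a / b] is the
annihilator in [R] of the class of [b] in [R_p / a R_p]. A maximal one among the
annihilators of nonzero classes is prime, hence equal to [p], and [b / a] is the
required element. *)
Lemma localization_conductor : exists2 x : {fraction R},
  ~ A x & forall r, p r <-> A (r%:F * x).
Proof.
have [noeR _ maxR] := dedR; have [a pa a0] := p_elt.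
have aF0 : a%:F != 0 by rewrite tofrac_eq0.
pose F := [set I | exists2 b : R, ~ A (b%:F / a%:F) &
  I = trace_ideal (a%:F / b%:F)].
have F_ideal : F `<=` @proper_ideal_set R.
  by move=> I [b ba ->]; apply: trace_ideal_proper; rewrite invf_div.
have F1 : F (trace_ideal (a%:F / 1%:F)).
  by exists 1 => //; rewrite tofrac1 mul1r localization_fracV //; apply.
have [I FI maxI] := noetherian_maximal noeR F_ideal F1.
have idI := F_ideal _ FI.
have [b ba Ib] := FI; pose x := b%:F / a%:F.
have IE r : I r <-> A (r%:F * x) by rewrite Ib /trace_ideal /= invf_div.
have Ip : I `<=` p.
  move=> r /IE rx; apply: contrapT => pr; apply: ba.
  have r0 : r%:F != 0 by apply: notpF_neq0.
  rewrite -[_ / _](mulKf r0); apply: localizationM => //.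
  by apply/localization_fracV => //; apply: notp_neq0.
have Ia : I a by apply/IE; rewrite mulrC divfK //; apply: localization_frac.
have prI : prime_ideal_set I.
  apply/prime_ideal_setP; split=> // u v Iuv.
  have [Iv|nIv] := pselect (I v); [by right|left].
  have vbE : (v * b)%:F / a%:F = v%:F * x by rewrite tofracM mulrA.
  (* What annihilates the class of [b] annihilates that of [v * b], which is
     nonzero as [v] is not in [I]; by maximality both annihilators agree. *)
  have JF : F (trace_ideal (a%:F / (v * b)%:F)).
    by exists (v * b) => //; rewrite vbE => H; apply/nIv/IE.
  rewrite -(maxI _ JF) /trace_ideal /= invf_div vbE.
    by rewrite mulrA -tofracM; apply/IE.
  move=> r /IE rI; rewrite /= mulrCA.
  by apply: localizationM => //; apply: localization_frac.
have [|_ maxIp] := maxR I.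
  split=> // I0; move: Ia; rewrite I0 /= => a_0; by rewrite a_0 eqxx in a0.
by exists x => // r; rewrite (maxIp p).
Qed.

(** Let [x] be given by [localization_conductor]. If [x] mapped [p] into
[p R_p], then after clearing denominators it would be integral over [R], hence
in [R_p]. So [m * x] is a unit of [R_p] for some [m] in [p], and then
[y / m = (y * x) / (m * x)] is in [R_p] for every [y] in [p R_p]. *)
Lemma localization_uniformizer : exists t : {fraction R},
  [/\ A t, ~ A t^-1 & forall y, A y -> ~ A y^-1 -> A (y / t)].
Proof.
have [noeR icR _] := dedR.
have [x nAx pE] := localization_conductor.
have [[m [pm mx0 mxV]]|Hno] :=
    pselect (exists m, [/\ p m, m%:F * x != 0 & A (m%:F * x)^-1]).
  have m0 : m != 0.
    by apply: contraNneq mx0 => ->; rewrite tofrac0 mul0r.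
  have mF0 : m%:F != 0 by rewrite tofrac_eq0.
  have x0 : x != 0 by apply: contraNneq mx0 => ->; rewrite mulr0.
  exists m%:F; split; first exact: localization_frac.
    by rewrite localization_fracV //; apply.
  move=> y Ay nyV; have [c [u [pc pu ->]]] := localization_nonunit Ay nyV.
  have -> : c%:F / u%:F / m%:F = (c%:F * x) * (u%:F)^-1 * (m%:F * x)^-1.
    by rewrite invfM [in RHS](mulrAC c%:F) mulrACA divff // mulr1.
  apply: localizationM => //; apply: localizationM; first exact/pE.
  by apply/localization_fracV => //; apply: notp_neq0.
exfalso.
(* Now [x] maps [p] into [p R_p], and one denominator [t] will serve for all
   the generators of [p]. *)
have clear r : p r ->
    exists2 t, ~ p t & exists2 c, p c & t%:F * x * r%:F = c%:F.
  move=> pr; have [rx0|rx0] := eqVneq (r%:F * x) 0.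
    exists 1 => //; exists 0 => //.
    by rewrite -mulrA [x * _]mulrC rx0 mulr0 tofrac0.
  have [|c [t [pc pt E]]] := localization_nonunit ((pE r).1 pr).
    by move=> rxV; apply: Hno; exists r.
  exists t => //; exists c => //.
  by rewrite -mulrA [x * _]mulrC E mulrC divfK // notpF_neq0.
have [s ps] := noeR p p_proper.
have [t pt ts] : exists2 t, ~ p t &
    forall r, r \in s -> exists2 c, p c & t%:F * x * r%:F = c%:F.
  have : forall r, r \in s -> p r by move=> r; rewrite ps => /ideal_span_mem.
  elim: {ps} s => [|r s IHs] sp; first by exists 1.
  have [|t pt ts] := IHs; first by move=> y ys; apply: sp; rewrite inE ys orbT.
  have [u pu [c pc E]] := clear r (sp r (mem_head _ _)).
  exists (t * u); first exact: pNM.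
  move=> y; rewrite inE => /predU1P[->|/ts[d pd E']].
    by exists (t * c); [exact: pMl | rewrite !tofracM -E !mulrA].
  exists (u * d); first exact: pMl.
  by rewrite !tofracM -E' (mulrC t%:F) !mulrA.
have [e eE] : exists e : R, t%:F * x = e%:F.
  apply/icR/(@integral_of_stable_span _ s); first by rewrite -ps.
  rewrite -ps.
  suff H : p `<=` [set r | exists2 c, p c & t%:F * x * r%:F = c%:F].
    by move=> r /H.
  rewrite {1}ps; apply: ideal_span_sub => //=.
    by exists 0; rewrite // tofrac0 mulr0.
  move=> a u v [c pc cE] [d pd dE]; exists (a * c + d); first exact: pL.
  by rewrite !tofracD !tofracM -cE -dE mulrDr; congr (_ + _); exact: mulrCA.
apply: nAx; exists e, t; split=> //.
by rewrite -eE mulrC mulKf // notpF_neq0.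
Qed.

(** In [R_p], dividing a counterexample by [t] gives another one with a strictly
larger trace, so no counterexample can have a maximal trace. Quotients then
cover the whole fraction field. *)
Lemma localization_factor t : A t -> ~ A t^-1 ->
  (forall y, A y -> ~ A y^-1 -> A (y / t)) ->
  forall z, z != 0 -> exists (n : int) u, [/\ z = t ^ n * u, A u & A u^-1].
Proof.
move=> At tV tdiv; have [noeR _ _] := dedR.
have t0 : t != 0.
  apply: contra_notN tV => /eqP ->; rewrite invr0 -tofrac0.
  exact: localization_frac.
pose good z := exists (n : int) u, [/\ z = t ^ n * u, A u & A u^-1].
have good_unit z : A z -> A z^-1 -> good z.
  by move=> Az zV; exists 0, z; rewrite expr0z mul1r.
have goodA z : z != 0 -> A z -> good z.
  move=> z0 Az; apply: contrapT => ngz.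
  pose F := [set I | exists y, [/\ y != 0, A y, ~ good y & I = trace_ideal y]].
  have F_ideal : F `<=` @proper_ideal_set R.
    move=> I [y [y0 Ay ngy ->]].
    by apply: trace_ideal_proper => /(good_unit _ Ay).
  have Fz : F (trace_ideal z) by exists z.
  have [_ [y [y0 Ay ngy ->]] maxI] := noetherian_maximal noeR F_ideal Fz.
  have Ayt : A (y / t) by apply: tdiv => // /(good_unit _ Ay).
  have yt0 : y / t != 0 by rewrite mulf_neq0 ?invr_eq0.
  have Fyt : F (trace_ideal (y / t)).
    exists (y / t); split=> // -[n [u [E Au uV]]]; apply: ngy.
    by exists (n + 1), u; rewrite expfzDr // expr1z mulrAC -E divfK.
  have sub : trace_ideal y `<=` trace_ideal (y / t).
    move=> r Ir; rewrite /trace_ideal /= invf_div mulrCA mulrC.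
    exact: localizationM.
  have [a [s [ps E]]] := Ayt.
  have sF0 := notpF_neq0 ps.
  have aE : a%:F = s%:F * (y / t) by rewrite E mulrC divfK.
  have : trace_ideal (y / t) a.
    by rewrite /trace_ideal /= aE mulfK //; apply: localization_frac.
  rewrite (maxI _ Fyt sub) /trace_ideal /= aE => H; apply: tV.
  have -> : t^-1 = (s%:F)^-1 * (s%:F * (y / t) / y)
    by rewrite -(mulrA s%:F) mulKf // mulrAC divff // mul1r.
  apply: localizationM => //; apply/localization_fracV => //; exact: notp_neq0.
move=> z z0; have [a [b [b0 zE]]] := fracE z.
have bF0 : b%:F != 0 by rewrite tofrac_eq0.
have aF0 : a%:F != 0 by apply: contraNneq z0 => a0; rewrite zE a0 mul0r.
have [n [u [aE Au uV]]] := goodA _ aF0 (localization_frac a).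
have [k [w [bE Aw wV]]] := goodA _ bF0 (localization_frac b).
exists (n - k), (u / w); split.
- by rewrite zE aE bE expfzDr // -invr_expz invfM mulrACA.
- exact: localizationM.
- by rewrite invf_div; apply: localizationM.
Qed.

Lemma localization_discrete_valuation :
  exists2 v, discrete_valuation v & valuation_ring v = A.
Proof.
have [t [At tV tdiv]] := localization_uniformizer.
apply: (discrete_valuation_of_uniformizer _ localizationD localizationM At tV).
  by rewrite -tofrac0; apply: localization_frac.
exact: localization_factor.
Qed.

Lemma prime_valuationP :
  discrete_valuation (prime_valuation p) /\
  valuation_ring (prime_valuation p) = A.
Proof.
have [v dv vA] := localization_discrete_valuation.
rewrite /prime_valuation; case: xgetP => [w _ [] //|/(_ v)[]].
by split=> // w [dw wA]; apply: valuation_ring_inj => //; rewrite vA.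
Qed.

End Dedekind.

End Localization.

Lemma localization_inj (R : idomainType) (p q : set R) :
  prime_ideal_set p -> prime_ideal_set q ->
  localization p = localization q -> p = q.
Proof.
move=> pp qp pq; apply/seteqP; split=> a ah; have [->|a0] := eqVneq a 0.
- by have [/proper_ideal_setP[]] := qp.
- apply: contrapT => /(localization_fracV qp a0).
  by rewrite -pq => /(localization_fracV pp a0).
- by have [/proper_ideal_setP[]] := pp.
- apply: contrapT => /(localization_fracV pp a0).
  by rewrite pq => /(localization_fracV qp a0).
Qed.

(** * Discrete valuations nonnegative on the domain *)

Definition valuation_center (R : idomainType) (v : {fraction R} -> \bar int) :
  set R := [set a | (0 < v a%:F)%E].

Section Center.
Variables (R : idomainType) (v : {fraction R} -> \bar int).
Hypotheses (dv : discrete_valuation v) (v_ge0 : forall a : R, (0 <= v a%:F)%E).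

Let v0 : v 0 = +oo%E. Proof. by case: dv. Qed.

Lemma not_valuation_center s :
  ~ valuation_center v s -> s != 0 /\ fine (v s%:F) = 0.
Proof.
rewrite /valuation_center /= => vs; have s0 : s != 0.
  by apply: contra_notN vs => /eqP ->; rewrite tofrac0 v0 ltry.
split=> //; apply/eqP; have sF0 : s%:F != 0 by rewrite tofrac_eq0.
have := v_ge0 s; move/negP: vs.
rewrite (dvE dv sF0) lee_fin lte_fin -leNgt /= => h1 h2.
by rewrite eq_le h1.
Qed.

Lemma valuation_center_prime : prime_ideal_set (valuation_center v).
Proof.
have v_fin (a : R) : a != 0 -> v a%:F = (fine (v a%:F))%:E.
  by move=> a0; rewrite -(dvE dv) // tofrac_eq0.
apply/prime_ideal_setP; split.
  apply/proper_ideal_setP; rewrite /valuation_center; split=> /=.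
  - by rewrite tofrac0 v0 ltry.
  - by rewrite tofrac1 (dvE dv) ?oner_neq0 // dv_fine1.
  - move=> a u w vu vw.
    have [->|u0] := eqVneq u 0; first by rewrite mulr0 add0r.
    have [->|a0] := eqVneq a 0; first by rewrite mul0r add0r.
    have vau : (0 < v (a * u)%:F)%E.
      rewrite v_fin ?mulf_neq0 // tofracM dv_fineM ?tofrac_eq0 //.
      move: vu (v_ge0 a); rewrite (v_fin a a0) (v_fin u u0) !lte_fin lee_fin.
      by move=> u_gt0 a_ge0; apply: ltr_wpDl.
    have [->|w0] := eqVneq w 0; first by rewrite addr0.
    have [->|auw0] := eqVneq (a * u + w) 0; first by rewrite tofrac0 v0 ltry.
    have [_ _ _ _ vD] := dv.
    rewrite tofracD; apply: lt_le_trans (vD _ _ _ _ _).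
    + by rewrite lt_min vau.
    + by rewrite tofrac_eq0 mulf_neq0.
    + by rewrite tofrac_eq0.
    + by rewrite -tofracD tofrac_eq0.
move=> a b vab; apply: contrapT => /not_orP[/not_valuation_center[a0 va]].
move=> /not_valuation_center[b0 vb]; move: vab; rewrite /valuation_center /=.
by rewrite v_fin ?mulf_neq0 // tofracM dv_fineM ?tofrac_eq0 // va vb addr0.
Qed.

(** Were the center zero, [v] would vanish on all nonzero elements of [R], hence
on all nonzero fractions, and could not be surjective. *)
Lemma valuation_center_neq0 : valuation_center v <> [set 0].
Proof.
move=> c0; have [_ _ _ /(_ 1)[x x0 vx] _] := dv.
have v_eq0 a : a != 0 -> fine (v a%:F) = 0.
  move=> a0; apply: (not_valuation_center _).2; rewrite c0 /= => a_0.
  by rewrite a_0 eqxx in a0.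
have [a [b [b0 xE]]] := fracE x.
have a0 : a != 0 by apply: contraNneq x0 => a0; rewrite xE a0 tofrac0 mul0r.
move: vx; rewrite xE (dvE dv) ?mulf_neq0 ?invr_eq0 ?tofrac_eq0 //.
by rewrite dv_fineM ?dv_fineV ?invr_eq0 ?tofrac_eq0 // !v_eq0.
Qed.

(** A discrete valuation ring has no room for a larger ring on which [v] is
nonnegative: if [x] is not in the localization, then [x^-1] is in its maximal
ideal, where [v] is positive, so [v x] is negative. *)
Lemma valuation_ring_center w : discrete_valuation w ->
  valuation_ring w = localization (valuation_center v) ->
  valuation_ring v = localization (valuation_center v).
Proof.
move=> dw wA; have c_prime := valuation_center_prime.
apply/seteqP; split=> x.
  have [->|x0] := eqVneq x 0.
    by move=> _; rewrite -tofrac0; apply: localization_frac.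
  move=> /(valuation_ringE dv x0) vx; apply: contrapT => xA.
  have xVA : localization (valuation_center v) x^-1.
    rewrite -wA; apply/(valuation_ringE dw); rewrite ?invr_eq0 //.
    move: xA; rewrite -wA (valuation_ringE dw) // => /negP.
    by rewrite dv_fineV // oppr_ge0 -ltNge => /ltW.
  have [|a [s [pa ps xE]]] := localization_nonunit xVA; first by rewrite invrK.
  have [s0 vs] := not_valuation_center ps.
  have a0 : a != 0.
    by apply: contra_eq_neq xE => ->; rewrite tofrac0 mul0r invr_eq0.
  move: pa; rewrite /valuation_center /= (dvE dv) ?tofrac_eq0 // lte_fin.
  have -> : a%:F = x^-1 * s%:F by rewrite xE divfK // tofrac_eq0.
  rewrite dv_fineM ?invr_eq0 ?tofrac_eq0 // vs addr0 dv_fineV // oppr_gt0.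
  by rewrite ltNge vx.
move=> [a [s [/not_valuation_center[s0 vs] ->]]].
have [->|a0] := eqVneq a 0.
  by rewrite tofrac0 mul0r /valuation_ring /= v0 leey.
apply/(valuation_ringE dv); first by rewrite mulf_neq0 ?invr_eq0 ?tofrac_eq0.
rewrite dv_fineM ?invr_eq0 ?tofrac_eq0 // dv_fineV ?tofrac_eq0 // vs oppr0 addr0.
by have := v_ge0 a; rewrite (dvE dv) ?tofrac_eq0.
Qed.

End Center.

Theorem theorem74 (R : idomainType) :
  dedekind R ->
  set_bij (nonzero_primes (R := R)) (nonneg_valuations (R := R))
          (prime_valuation (R := R)).
Proof.
move=> dedR; split.
- move=> p [pp p0]; have [dv vA] := prime_valuationP pp dedR p0.
  split=> // a; have : localization p a%:F by apply: localization_frac.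
  by rewrite -vA.
- move=> p q /set_mem[pp p0] /set_mem[qp q0] pq.
  apply: localization_inj => //.
  have [_ <-] := prime_valuationP pp dedR p0.
  by have [_ <-] := prime_valuationP qp dedR q0; rewrite pq.
- move=> v [dv v_ge0].
  have pp := valuation_center_prime dv v_ge0.
  have p0 := valuation_center_neq0 dv v_ge0.
  have [dw wA] := prime_valuationP pp dedR p0.
  exists (valuation_center v) => //.
  apply: valuation_ring_inj => //.
  by rewrite wA (valuation_ring_center dv v_ge0 dw).
Qed.
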